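(* Let $\lambda/\mu$ be a skew shape (partitions $\mu\subseteq\lambda$). A diagram $S\subseteq[\lambda]$ is a pleasant diagram in $\mathcal{P}(\lambda/\mu)$ if and only if $S\subseteq[\lambda]\setminus D$ for some excited diagram $D\in\mathcal{E}(\lambda/\mu)$.
   Context: $[\lambda]=\{(i,j):1\le i\le \ell(\lambda),\,1\le j\le\lambda_i\}$ is the Young diagram (rows numbered from the top, columns from the left). Pleasant diagrams: for an integer $k$ with $1-\ell(\lambda)\le k\le\lambda_1-1$, let $\mathsf{d}_k=\{(i,j)\in[\lambda]\setminus[\mu]: j-i=k\}$, let $s_k=|\mathsf{d}_k|$, and let $\square_k^\lambda$ be the largest rectangle with $i$ rows and $i+k$ columns, with northwest corner $(1,1)$, that fits inside $[\lambda]$. A descending chain of length $s$ in a set of cells is a sequence of cells $(i_1,j_1),\ldots,(i_s,j_s)$ of the set with $i_1<\cdots<i_s$ and $j_1<\cdots<j_s$. A subset $S\subseteq[\lambda]$ is a pleasant diagram of $\lambda/\mu$ if for every $k$ with $1-\ell(\lambda)\le k\le\lambda_1-1$, every descending chain in $S\cap\square_k^\lambda$ has length at most $s_k$; $\mathcal{P}(\lambda/\mu)$ is the set of these. Excited diagrams: for $D\subseteq[\lambda]$, a cell $(i,j)\in D$ is active if $(i+1,j)$, $(i,j+1)$, $(i+1,j+1)$ all lie in $[\lambda]\setminus D$; an excited move replaces an active cell $(i,j)$ of $D$ by $(i+1,j+1)$. $\mathcal{E}(\lambda/\mu)$ is the set of all subsets of $[\lambda]$ obtained from $[\mu]$ by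 a (possibly empty) sequence of excited moves. *)

(* Defs.v *)
From HB Require Import structures.
From mathcomp Require Import all_boot all_order all_algebra finmap.

Set Implicit Arguments.
Unset Strict Implicit.
Unset Printing Implicit Defensive.

Import Order.TTheory GRing.Theory Num.Theory.
Local Open Scope fset_scope.

(* A partition is the weakly decreasing list of its positive parts, so that
   [size la] is its length. *)
Definition is_part (la : seq nat) : bool := sorted geq la && (0 \notin la).

(* Parts are numbered from 1 and [part la i = 0] for [i > size la]. *)
Definition part (la : seq nat) (i : nat) : nat := nth 0 la i.-1.

(* Cells (i, j) are numbered from (1, 1), rows first. *)
Notation cell := (nat * nat)%type.

Definition young (la : seq nat) : {fset cell} :=
  [fset c in [seq (i, j) | i <- iota 1 (size la), j <- iota 1 (part la i)]].

Definition content (c : cell) : int := (c.2%:Z - c.1%:Z)%R.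

Definition diagonal (la mu : seq nat) (k : int) : {fset cell} :=
  [fset c in young la `\` young mu | content c == k].

Definition in_range (la : seq nat) (k : int) : bool :=
  (1 - (size la)%:Z <= k <= (part la 1)%:Z - 1)%R.

Definition rect (m n : nat) : {fset cell} :=
  [fset c in [seq (i, j) | i <- iota 1 m, j <- iota 1 n]].

Definition rect_fits (la : seq nat) (k : int) (i : nat) : bool :=
  (0 <= i%:Z + k)%R && (rect i `|(i%:Z + k)%R|%N `<=` young la).

(* For k in range, a nonempty rectangle fits (one ending at the first cell of
   diagonal k), so restricting to i <= size la loses nothing: any taller
   rectangle that fits is empty. *)
Definition square_rows (la : seq nat) (k : int) : nat :=
  \max_(i < (size la).+1 | rect_fits la k i) i.

Definition square (la : seq nat) (k : int) : {fset cell} :=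
  let i := square_rows la k in rect i `|(i%:Z + k)%R|%N.

(* [sorted] only compares neighbours, but the relation is transitive. *)
Definition descending (c : seq cell) : bool :=
  sorted (fun x y : cell => (x.1 < y.1) && (x.2 < y.2)) c.

Definition pleasant (la mu : seq nat) (S : {fset cell}) : Prop :=
  S `<=` young la /\
  forall k : int, in_range la k ->
  forall c : seq cell, descending c -> {subset c <= S `&` square la k} ->
    size c <= #|` diagonal la mu k|.

Definition active (la : seq nat) (D : {fset cell}) (c : cell) : bool :=
  [&& c \in D, (c.1.+1, c.2) \in young la `\` D,
      (c.1, c.2.+1) \in young la `\` D & (c.1.+1, c.2.+1) \in young la `\` D].

Definition excite (D : {fset cell}) (c : cell) : {fset cell} :=
  (c.1.+1, c.2.+1) |` (D `\ c).

Inductive excited (la mu : seq nat) : {fset cell} -> Prop :=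
| excited_start : excited la mu (young mu)
| excited_move (D : {fset cell}) (c : cell) :
    excited la mu D -> active la D c -> excited la mu (excite D c).

(* Main.v *)
(* An excited diagram is the set of cells of mu, each moved by t(c) diagonal
   steps inside lambda, where t is weakly increasing along rows and columns.
   Given S, let t(a, b) be the largest n such that S has a descending chain of
   length n with all cells strictly northwest of (a + n, b + n).  This t is
   weakly increasing, and by maximality (a + t, b + t) is not in S; pleasantness
   on the diagonal of (a, b) is what keeps it inside lambda.  Conversely, if the
   diagram of t avoids S, then t(a, b) >= n for each such n (induct on n, looking
   at the cell of mu on the diagonal of the last cell of the chain).  Applied to
   the last cell of mu on diagonal k, this bounds the chains in the k-th
   rectangle by s_k. *)
Require Import Defs.
From mathcomp Require Import all_boot all_order all_algebra finmap zify.

Local Open Scope fset_scope.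
Local Open Scope nat_scope.

(** * Diagonals and largest rectangles in coordinates *)

Lemma in_young la i j :
  ((i, j) \in young la) = [&& 0 < i <= size la & 0 < j <= part la i].
Proof.
rewrite /young !inE; apply/allpairsPdep/idP => [[x [y []]]|].
  by rewrite !mem_iota => hx hy [-> ->]; lia.
by move=> h; exists i, j; rewrite !mem_iota; split=> //; lia.
Qed.

Lemma young_gt0 {la c} : c \in young la -> (0 < c.1) && (0 < c.2).
Proof. by case: c => i j; rewrite in_young /=; lia. Qed.

Lemma young_down {la i j a b} : is_part la -> (a, b) \in young la ->
  0 < i <= a -> 0 < j <= b -> (i, j) \in young la.
Proof.
case/andP=> la_sorted _; rewrite !in_young => /andP[ha hb] hi hj.
suff: part la a <= part la i by lia.
apply: (sorted_leq_nth (leT := geq)) => //; rewrite ?inE; try lia.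
by move=> x y z /=; lia.
by move=> x; exact: leqnn.
Qed.

(* The diagonal of content [v - u] starts at [(u + 1, v + 1)] when [u] or [v] is 0. *)
Lemma diag_length {la} u v : is_part la -> u = 0 \/ v = 0 ->
  {q | forall x, ((u + x, v + x) \in young la) = (0 < x <= q)}.
Proof.
move=> la_part uv0.
have ex_out : exists x, (u + x.+1, v + x.+1) \notin young la.
  by exists (size la); rewrite in_young; lia.
case: (ex_minnP ex_out) => q q_out q_min; exists q => x.
apply/idP/idP => [x_in|/andP[]].
  have := young_gt0 x_in; rewrite /=.
  have [|lt_qx] := leqP x q; first by lia.
  by case/negP: q_out; apply: (young_down la_part x_in); lia.
case: x => // x _ lt_xq; apply/negPn/negP => /q_min; lia.
Qed.

Lemma part_gt0 {la i} : is_part la -> 0 < i <= size la -> 0 < part la i.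
Proof.
case/andP=> _ la_neq0 /andP[i_gt0 i_la]; rewrite lt0n.
by apply: contraNneq la_neq0 => <-; apply: mem_nth; rewrite prednK.
Qed.

Lemma in_range_diag_start {la k} u v : is_part la -> u = 0 \/ v = 0 ->
  k = (v%:Z - u%:Z)%R -> in_range la k -> (u + 1, v + 1) \in young la.
Proof.
move=> la_part uv0 kE; rewrite /in_range kE in_young => k_range.
case: uv0 => [u0|v0].
  have v_la : v < part la 1 by rewrite u0 in k_range; lia.
  have la_gt0 : 0 < size la by case: (la) v_la.
  by rewrite u0 add0n; lia.
have u_la : 0 < u + 1 <= size la.
  by rewrite v0 in k_range; case: u k_range {kE} => [|u]; lia.
by have := part_gt0 la_part u_la; lia.
Qed.

Lemma in_rect m n i j : ((i, j) \in rect m n) = (0 < i <= m) && (0 < j <= n).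
Proof.
rewrite /rect !inE; apply/allpairsPdep/idP => [[x [y []]]|].
  by rewrite !mem_iota => hx hy [-> ->]; lia.
by move=> h; exists i, j; rewrite !mem_iota; split=> //; lia.
Qed.

(** A nonempty rectangle fits in [la] exactly when its southeast corner does. That corner has
    content [k], so the largest rectangle ends at the last cell of the diagonal. *)
Lemma in_square la k u v q : is_part la -> u = 0 \/ v = 0 -> k = (v%:Z - u%:Z)%R ->
  (forall x, ((u + x, v + x) \in young la) = (0 < x <= q)) -> 0 < q ->
  forall c, (c \in square la k) = (0 < c.1 <= u + q) && (0 < c.2 <= v + q).
Proof.
move=> la_part uv0 kE diagE q_gt0.
have q_in : (u + q, v + q) \in young la by rewrite diagE q_gt0 leqnn.
have rowsE : square_rows la k = u + q.
  apply/eqP; rewrite eqn_leq; apply/andP; split.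
    apply/bigmax_leqP => i /andP[ik_ge0 /fsubsetP rect_sub].
    have [|lt_ui] := leqP i u; first by lia.
    have : (u + (i - u), v + (i - u)) \in young la.
      by apply: rect_sub; rewrite in_rect; lia.
    rewrite diagE; lia.
  have lt_q : u + q < (size la).+1 by move: q_in; rewrite in_young; lia.
  apply: (@leq_bigmax_cond _ _ (fun i : 'I__ => i : nat) (Ordinal lt_q)).
  rewrite /rect_fits /=; apply/andP; split; first by lia.
  apply/fsubsetP => -[i j]; rewrite in_rect => ij.
  by apply: (young_down la_part q_in); lia.
case=> i j; rewrite /square rowsE in_rect /=; lia.
Qed.

Lemma in_diagonal la mu k c : (c \in diagonal la mu k) =
  [&& c \notin young mu, c \in young la & content c == k].
Proof. by rewrite /diagonal !inE andbA. Qed.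

Lemma in_excite (D : {fset nat * nat}) c d :
  (d \in excite D c) = (d == (c.1.+1, c.2.+1)) || (d != c) && (d \in D).
Proof. by rewrite /excite !inE. Qed.

Lemma card_diagonal la mu k u v q r : u = 0 \/ v = 0 -> k = (v%:Z - u%:Z)%R ->
  (forall x, ((u + x, v + x) \in young la) = (0 < x <= q)) ->
  (forall x, ((u + x, v + x) \in young mu) = (0 < x <= r)) ->
  #|` diagonal la mu k| = q - r.
Proof.
move=> uv0 kE laE muE.
have -> : diagonal la mu k =
    [fset (u + x, v + x) | x in [fset y in iota r.+1 (q - r)]].
  apply/fsetP => -[i j]; apply/idP/imfsetP => /= [|[x]].
    rewrite in_diagonal /content /= => /and3P[ij_mu ij_la /eqP ijk].
    have := young_gt0 ij_la; rewrite /= => ij0.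
    have [iE jE] : i = u + (i - u) /\ j = v + (i - u) by lia.
    exists (i - u); last by rewrite -iE -jE.
    move: ij_la ij_mu; rewrite iE jE laE muE in_fset /= mem_iota; lia.
  rewrite in_fset /= mem_iota => hx [-> ->]; rewrite in_diagonal laE muE /content /=; lia.
rewrite card_imfset /=; last by move=> x y []; lia.
by rewrite card_fseq undup_id ?iota_uniq // size_iota.
Qed.

(** * Excited diagrams as admissible shifts of the cells of [mu] *)

Definition shift (c : nat * nat) (t : nat) : nat * nat := (c.1 + t, c.2 + t).

(* The weak and the strict northwest order. *)
Definition nw (c d : nat * nat) : bool := (c.1 <= d.1) && (c.2 <= d.2).

Definition snw (c d : nat * nat) : bool := (c.1 < d.1) && (c.2 < d.2).

(* Reading [t c] as the number of excited moves made by the cell [c], the first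
   condition says that moved cells do not overtake one another. *)
Definition admissible (la mu : seq nat) (t : nat * nat -> nat) : Prop :=
  {in young mu &, forall c d, nw c d -> t c <= t d} /\
  {in young mu, forall c, shift c (t c) \in young la}.

Definition shifted (mu : seq nat) (t : nat * nat -> nat) : {fset nat * nat} :=
  [fset shift c (t c) | c in young mu].

(** Cells with equal images share a diagonal, hence are comparable; by monotonicity the southeast
    one moves at least as far, so it cannot be caught up. *)
Lemma shift_inj la mu t : is_part mu -> admissible la mu t ->
  {in young mu &, forall c d, shift c (t c) = shift d (t d) -> c = d}.
Proof.
move=> mu_part [t_mono _] [a b] [i j] c_mu d_mu [/= e1 e2].
case: (leqP a i) => h.
  have := t_mono _ _ c_mu d_mu; rewrite /nw /= => ?; congr pair; lia.
have := t_mono _ _ d_mu c_mu; rewrite /nw /= => ?; congr pair; lia.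
Qed.

Definition bump_at (t : nat * nat -> nat) (c d : nat * nat) : nat :=
  t d + (d == c).

(** Translates an excited move into one more diagonal step of [c]. Injectivity ensures that no other
    cell of [mu] has the image being removed. *)
Lemma shifted_bump la mu t c : is_part mu -> admissible la mu t ->
  c \in young mu ->
  shifted mu (bump_at t c) = excite (shifted mu t) (shift c (t c)).
Proof.
move=> mu_part t_adm c_mu; apply/fsetP => d.
rewrite in_excite; apply/imfsetP/idP => /= [[e e_mu ->]|].
  rewrite /bump_at; have [->|ne_ec] /= := eqVneq e c.
    by rewrite addn1 /shift /= !addnS eqxx.
  rewrite addn0; apply/orP; right; apply/andP; split; last by apply/imfsetP; exists e.
  by apply: contraNneq ne_ec => /(shift_inj _ _ _ mu_part t_adm) ->.
case/orP => [/eqP ->|/andP[ne /imfsetP /= [e e_mu dE]]].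
  by exists c => //; rewrite /bump_at eqxx /= addn1 /shift /= !addnS.
exists e => //; rewrite /bump_at; have [ec|] /= := eqVneq e c; last by rewrite addn0.
by rewrite dE ec eqxx in ne.
Qed.

Lemma excited_admissible la mu D : is_part mu -> young mu `<=` young la ->
  excited la mu D -> exists2 t, admissible la mu t & D = shifted mu t.
Proof.
move=> mu_part /fsubsetP mu_la.
elim=> [|{}D c _ [t t_adm ->] /and4P[]].
  exists (fun=> 0); first by split=> // -[a b] ab; rewrite /shift /= !addn0 mu_la.
  rewrite /shifted /shift; apply/fsetP => -[a b].
  apply/idP/imfsetP => /= [ab|[[i j] ij ->]]; last by rewrite /= !addn0.
  by exists (a, b); rewrite //= !addn0.
move=> /imfsetP /= [[a b] ab_mu ->] /=.
rewrite !in_fsetD /= => /andP[down _] /andP[right _] /andP[_ diag_la].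
exists (bump_at t (a, b)); last by rewrite (shifted_bump la).
case: (t_adm) => t_mono t_la; split=> /= [[i j] [i' j'] c_mu d_mu|[i j] c_mu];
    rewrite /bump_at; last first.
  by case: eqVneq => [[-> ->]|_] /=; rewrite ?addn0 ?addn1 ?t_la // /shift /= !addnS.
move=> cd; have := t_mono _ _ c_mu d_mu cd.
case: (eqVneq (i, j) (a, b)) => [[ia jb]|_]; last by lia.
case: eqVneq => [_|ne]; first by lia.
rewrite ia jb in cd c_mu * => le_t.
have ab0 := young_gt0 ab_mu; rewrite /nw /= in ab0 cd.
(* Monotonicity could only break at a cell [(i', j')] southeast of [(a, b)] with the same [t]. Then
   the neighbour of [(a, b)] below or to the right, squeezed between them, also has this [t], and
   its image fills a cell that activity requires to be free. *)
suff : t (a, b) <> t (i', j') by lia.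
move=> e; have [lt_a|le_a] := ltnP a i'.
  have ab'_mu : (a.+1, b) \in young mu by apply: (young_down mu_part d_mu); lia.
  case/negP: down; apply/imfsetP; exists (a.+1, b) => //.
  have le1 : t (a, b) <= t (a.+1, b) by apply: t_mono => //; rewrite /nw /=; lia.
  have le2 : t (a.+1, b) <= t (i', j') by apply: t_mono => //; rewrite /nw /=; lia.
  by rewrite /shift /=; congr pair; lia.
have lt_b : b < j'.
  suff : b <> j' by lia.
  by move=> bj; case/eqP: ne; congr pair; lia.
have ab'_mu : (a, b.+1) \in young mu by apply: (young_down mu_part d_mu); lia.
case/negP: right; apply/imfsetP; exists (a, b.+1) => //.
have le1 : t (a, b) <= t (a, b.+1) by apply: t_mono => //; rewrite /nw /=; lia.
have le2 : t (a, b.+1) <= t (i', j') by apply: t_mono => //; rewrite /nw /=; lia.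
by rewrite /shift /=; congr pair; lia.
Qed.

(* Undo the last move of a moved cell [(a, b)] with [a + b] minimal: the cells
   northwest of it have not moved, so monotonicity survives. *)
Lemma admissible_excited la mu t : is_part la -> is_part mu ->
  admissible la mu t -> excited la mu (shifted mu t).
Proof.
move=> la_part mu_part.
have [n] := ubnP (\sum_(c <- young mu) t c).
elim: n t => // n IHn t lt_n t_adm; case: (t_adm) => t_mono t_la.
have [/allP t0|/allPn[c0 c0_mu tc0]] := boolP (all (fun c => t c == 0) (young mu)).
  have -> : shifted mu t = young mu; last exact: excited_start.
  apply/fsetP => -[a b]; apply/imfsetP/idP => /= [[[i j] ij ->]|ab].
    by rewrite (eqP (t0 _ ij)) /shift /= !addn0.
  by exists (a, b); rewrite // (eqP (t0 _ ab)) /shift /= !addn0.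
have ex_n : exists m, has (fun c => (t c != 0) && (c.1 + c.2 == m)) (young mu).
  by exists (c0.1 + c0.2); apply/hasP; exists c0 => //; rewrite tc0 eqxx.
case: (ex_minnP ex_n) => m /hasP /= [[a b] ab_mu /andP[tab /eqP /= mE] m_min].
have below c : c \in young mu -> nw c (a, b) -> c != (a, b) -> t c = 0.
  case: c => i j ij_mu; rewrite /nw /= => ij_ab ne.
  apply/eqP; apply/negPn/negP => tij.
  have : m <= i + j by apply: m_min; apply/hasP; exists (i, j); rewrite ?tij ?eqxx.
  by move=> le_m; case/eqP: ne; congr pair; lia.
pose t' c := t c - (c == (a, b)).
have t'E c : c != (a, b) -> t' c = t c by rewrite /t' => /negPf ->; rewrite subn0.
have t'ab : (t' (a, b)).+1 = t (a, b) by rewrite /t' eqxx; lia.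
have tE : t =1 bump_at t' (a, b).
  move=> c; rewrite /bump_at; have [->|/t'E ->] /= := eqVneq c (a, b).
    by rewrite -t'ab addn1.
  by rewrite addn0.
have le_t' c : t' c <= t c by exact: leq_subr.
have t'_adm : admissible la mu t'.
  split=> [c d c_mu d_mu cd|/= [i j] c_mu].
    have le_cd := t_mono _ _ c_mu d_mu cd.
    have [dE|/t'E ->] := eqVneq d (a, b); last exact: leq_trans (le_t' c) le_cd.
    have [->|ne] := eqVneq c (a, b); first by rewrite dE.
    by rewrite (t'E _ ne) below // -dE.
  have := t_la _ c_mu; have := young_gt0 c_mu; rewrite /shift /= => ij0 in_la.
  have le_ij := le_t' (i, j).
  by apply: (young_down la_part in_la); clearbody t'; lia.
have -> : shifted mu t = shifted mu (bump_at t' (a, b)).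
  by apply/fsetP => c; apply/imfsetP/imfsetP => -[d d_mu ->]; exists d; rewrite ?tE.
clearbody t'; rewrite (shifted_bump la) //; apply: excited_move.
  apply: (IHn _ _ t'_adm); move: lt_n; rewrite ltnS; apply: leq_trans.
  rewrite !(big_fsetD1 (a, b) ab_mu) -t'ab /=.
  rewrite addSn ltnS leq_add2l; apply: leq_sum => c _; exact: le_t'.
have ab_gt0 := young_gt0 ab_mu; rewrite /= in ab_gt0.
have ab_la := t_la _ ab_mu; rewrite -t'ab /shift /= !addnS in ab_la.
case: t'_adm => t'_mono _.
move: t'ab ab_la; move pE: (t' (a, b)) => p t'ab ab_la.
(* A cell of [mu] with image [(x, y)] has content within 1 of that of [(a, b)], so the two are
   comparable. If it is another cell to the southeast, it moves at least [p.+1] steps and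
   overshoots; if it is to the northwest, it moves at most [p] steps and falls short. *)
have free x y : a + p <= x <= (a + p).+1 -> b + p <= y <= (b + p).+1 ->
    a + p + (b + p) < x + y -> (x, y) \in young la `\` shifted mu t'.
  move=> x_le y_le xy; rewrite in_fsetD; apply/andP; split; last first.
    by apply: (young_down la_part ab_la); lia.
  apply/imfsetP => /= -[[i j] ij_mu ijE].
  have iE : x = i + t' (i, j) by case: ijE.
  have jE : y = j + t' (i, j) by case: ijE.
  have [[ia jb]|/eqP ne] := eqVneq (i, j) (a, b).
    by move: iE jE; rewrite ia jb pE => iE jE; lia.
  have [le_ab|le_ij] : nw (a, b) (i, j) \/ nw (i, j) (a, b) by rewrite /nw /=; lia.
    have := t_mono _ _ ab_mu ij_mu le_ab; rewrite -t'ab -t'E; last exact/eqP.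
    rewrite /nw /= in le_ab => lt_p; case: ne; congr pair; lia.
  have := t'_mono _ _ ij_mu ab_mu le_ij; rewrite pE.
  by rewrite /nw /= in le_ij; lia.
apply/and4P; split; first by apply/imfsetP; exists (a, b); rewrite ?pE.
all: by rewrite /shift /=; apply: free; lia.
Qed.

(** * Descending chains, built from their southeast end *)

Fixpoint has_chain (S : {fset nat * nat}) (n : nat) (c : nat * nat) : bool :=
  if n is n'.+1 then has (fun d => snw d c && has_chain S n' d) S else true.

Lemma descending_rcons s d :
  descending (rcons s d) = all (snw^~ d) s && descending s.
Proof.
have snw_trans : transitive snw by move=> x y z; rewrite /snw; lia.
by rewrite /descending !(sorted_pairwise snw_trans) pairwise_rcons.
Qed.

Lemma has_chainP S n c :
  reflect (exists s, [/\ descending s, {subset s <= S}, all (snw^~ c) s & size s = n])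
          (has_chain S n c).
Proof.
elim: n c => [|n IHn] c /=; first by left; exists [::].
apply: (iffP hasP) => [[d dS /andP[dc /IHn[s [s_desc s_sub s_d s_n]]]]|].
  exists (rcons s d); split; last by rewrite size_rcons s_n.
  - by rewrite descending_rcons s_d.
  - by move=> e; rewrite mem_rcons inE => /orP[/eqP ->|/s_sub].
  - rewrite all_rcons dc; apply/allP => e /(allP s_d) /=.
    by move: dc; rewrite /snw; lia.
case; elim/last_ind => [[]//|s d _ [s_desc s_sub s_c]].
rewrite size_rcons => -[s_n]; move: s_desc s_c.
rewrite descending_rcons all_rcons => /andP[s_d s_desc] /andP[dc _].
exists d; first by apply: s_sub; rewrite mem_rcons mem_head.
rewrite dc; apply/IHn; exists s; split=> // e e_s.
by apply: s_sub; rewrite mem_rcons inE e_s orbT.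
Qed.

Lemma has_chain_nw S n c d : nw c d -> has_chain S n c -> has_chain S n d.
Proof.
case: n => //= n cd /hasP[e eS /andP[ec e_n]].
by apply/hasP; exists e => //; rewrite e_n andbT; move: cd ec; rewrite /nw /snw; lia.
Qed.

(** Drop the last cell of the chain: it is weakly northwest of [shift c n], and the others are
    strictly northwest of it. *)
Lemma has_chain_shiftS S n c :
  has_chain S n.+1 (shift c n.+1) -> has_chain S n (shift c n).
Proof.
case/hasP=> d _ /andP[dc]; apply: has_chain_nw.
by move: dc; rewrite /nw /snw /=; lia.
Qed.

Lemma has_chain_shiftW S m n c : m <= n ->
  has_chain S n (shift c n) -> has_chain S m (shift c m).
Proof.
elim: n => [|n IHn]; first by rewrite leqn0 => /eqP ->.
by rewrite leq_eqVlt => /predU1P[->//|/IHn IH /has_chain_shiftS].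
Qed.

Lemma has_chain_lt S n c : {in S, forall d, (0 < d.1) && (0 < d.2)} ->
  has_chain S n c -> (0 < c.1) && (0 < c.2) -> (n < c.1) && (n < c.2).
Proof.
move=> S_gt0; elim: n c => [|n IHn] c //= /hasP[d dS /andP[dc /IHn]].
by move/(_ (S_gt0 _ dS)); move: dc; rewrite /snw; lia.
Qed.

Lemma has_chain_admissible la mu t S n c : is_part mu -> admissible la mu t ->
  {in S, forall d, (0 < d.1) && (0 < d.2)} -> [disjoint S & shifted mu t] ->
  c \in young mu -> has_chain S n (shift c n) -> n <= t c.
Proof.
move=> mu_part [t_mono _] S_gt0 /fdisjointP S_dis.
elim: n c => // n IHn [a b] c_mu Sn.
have := IHn _ c_mu (has_chain_shiftS _ _ _ Sn); rewrite leq_eqVlt => /predU1P[nE|//].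
case/hasP: Sn => -[i j] dS /andP[dc d_n]; exfalso.
have := has_chain_lt _ _ _ S_gt0 d_n (S_gt0 _ dS); move: dc; rewrite /snw /= => dc dn.
(* Moving the last chain cell back [n] steps gives a cell of [mu]: [n] earlier cells force
   [i, j > n]. Its [t] is at least [n] by induction and at most [t (a, b) = n], so [(i, j)] is its
   image, although [(i, j)] is in [S]. *)
have c'_mu : (i - n, j - n) \in young mu by apply: (young_down mu_part c_mu); lia.
have dE : (i, j) = shift (i - n, j - n) n by rewrite /shift /=; congr pair; lia.
have le1 : n <= t (i - n, j - n) by apply: IHn; rewrite -?dE.
have le2 : t (i - n, j - n) <= t (a, b) by apply: t_mono; rewrite // /nw /=; lia.
case/negP: (S_dis _ dS); apply/imfsetP; exists (i - n, j - n) => //=.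
by rewrite {1}dE; congr shift; lia.
Qed.

(** * Pleasantness against chains, and the two implications *)

Lemma content_split (k : int) :
  {uv : nat * nat | (uv.1 = 0 \/ uv.2 = 0) & k = (uv.2%:Z - uv.1%:Z)%R}.
Proof.
by case: k => n; [exists (0, n)|exists (n.+1, 0)] => /=; lia.
Qed.

Lemma pleasant_chain_in_young la mu S c n : is_part la -> is_part mu ->
  young mu `<=` young la -> pleasant la mu S -> c \in young mu ->
  has_chain S n (shift c n) -> shift c n \in young la.
Proof.
move=> la_part mu_part /fsubsetP mu_la [S_la S_pleasant].
case: c => a b c_mu Sn; apply/negPn/negP => c_out.
have [u [v [x [uv0 aE bE]]]] :
    exists u v x, [/\ u = 0 \/ v = 0, a = u + x & b = v + x].
  (* Truncated subtraction makes one of the two offsets 0. *)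
  by exists (a - b), (b - a), (minn a b); split; lia.
have [q laE] := diag_length u v la_part uv0.
have [r muE] := diag_length u v mu_part uv0.
have c_la := mu_la _ c_mu; move: (c_mu) (c_la).
rewrite aE bE laE muE => x_r x_q.
have lt_q : q < x + n.
  by move: c_out; rewrite /shift /= aE bE -!addnA laE; lia.
(* [q.+1 - x] is the least number of steps taking the cell out of [la]. The chain for it lies
   strictly northwest of [(u + q.+1, v + q.+1)], hence in the rectangle, and [x <= r] makes it
   longer than [q - r]. *)
have /has_chainP[s [s_desc s_S s_c s_size]] :
    has_chain S (q.+1 - x) (shift (a, b) (q.+1 - x)).
  by apply: (has_chain_shiftW _ _ _ _ _ Sn); lia.
have q_gt0 : 0 < q by lia.
have squareE := in_square _ _ _ _ _ la_part uv0 (erefl (v%:Z - u%:Z)%R) laE q_gt0.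
have k_range : in_range la (v%:Z - u%:Z)%R.
  have : (u + 1, v + 1) \in young la by rewrite laE.
  have : (1, v + 1) \in young la by apply: (young_down la_part c_la); lia.
  by rewrite !in_young /in_range; lia.
have := S_pleasant _ k_range _ s_desc.
rewrite (card_diagonal _ _ _ _ _ _ _ uv0 erefl laE muE) s_size.
suff s_sq : {subset s <= S `&` square la (v%:Z - u%:Z)%R} by move/(_ s_sq); lia.
move=> d d_s; rewrite in_fsetI (s_S _ d_s) squareE.
have := young_gt0 (fsubsetP S_la _ (s_S _ d_s)).
by have := allP s_c _ d_s; rewrite /snw /= aE bE; lia.
Qed.

Lemma avoiding_excited_pleasant la mu S D : is_part la -> is_part mu ->
  young mu `<=` young la -> excited la mu D -> S `<=` young la `\` D ->
  pleasant la mu S.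
Proof.
move=> la_part mu_part mu_la D_exc.
rewrite fsubsetD => /andP[S_la S_D]; split=> // k k_range s s_desc s_S.
have [t t_adm DE] := excited_admissible _ _ _ mu_part mu_la D_exc.
have [[u v] /= uv0 kE] := content_split k.
have [q laE] := diag_length u v la_part uv0.
have [r muE] := diag_length u v mu_part uv0.
rewrite (card_diagonal _ _ _ _ _ _ _ uv0 kE laE muE).
have S_gt0 : {in S, forall d, (0 < d.1) && (0 < d.2)}.
  by move=> d dS; apply: (young_gt0 (fsubsetP S_la _ dS)).
have q_gt0 : 0 < q.
  by have := in_range_diag_start u v la_part uv0 kE k_range; rewrite laE.
have Sn : has_chain S (size s) (u + q.+1, v + q.+1).
  apply/has_chainP; exists s; split=> // [d /s_S|].
    by rewrite in_fsetI => /andP[].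
  apply/allP => d /s_S; rewrite in_fsetI => /andP[_].
  by rewrite (in_square _ _ _ _ _ la_part uv0 kE laE q_gt0) /snw /=; lia.
rewrite leqNgt; apply/negP => lt_s.
(* If the diagonal misses [mu], the bound is [q], and it holds because coordinates increase strictly
   along a chain and [u] or [v] is 0. *)
have [r0|r_gt0] := posnP r.
  by have := has_chain_lt _ _ _ S_gt0 Sn; rewrite /=; lia.
have c_mu : (u + r, v + r) \in young mu by rewrite muE r_gt0 leqnn.
(* A chain longer than [q - r] would push the last cell of [mu] on this diagonal past row [u + q],
   out of [la]. *)
have le_t : size s <= t (u + r, v + r).
  apply: (has_chain_admissible _ _ _ _ _ _ mu_part t_adm S_gt0 _ c_mu).
    by rewrite -DE.
  by apply: has_chain_nw Sn; rewrite /nw /shift /=; lia.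
have := (t_adm.2 _ c_mu); rewrite /shift /= -!addnA laE; lia.
Qed.

Theorem theorem6p10 (la mu : seq nat) (S : {fset nat * nat}) :
  is_part la -> is_part mu -> young mu `<=` young la -> S `<=` young la ->
  (pleasant la mu S <->
   exists D : {fset nat * nat}, excited la mu D /\ S `<=` young la `\` D).
Proof.
move=> la_part mu_part mu_la S_la; split; last first.
  by case=> D [D_exc S_D]; apply: (avoiding_excited_pleasant _ _ _ D).
move=> S_pleasant.
pose t c := \max_(n < (size la).+1 | has_chain S n (shift c n)) n.
have t_chain c : has_chain S (t c) (shift c (t c)).
  have [|n] := @eq_bigmax_cond _ (fun n : 'I_(size la).+1 => has_chain S n (shift c n))
    (fun n : 'I__ => n : nat).
    by apply/card_gt0P; exists ord0.
  by rewrite /t => Sn ->.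
have chain_la c n : c \in young mu -> has_chain S n (shift c n) ->
    shift c n \in young la by exact: pleasant_chain_in_young.
have t_max c n : c \in young mu -> has_chain S n (shift c n) -> n <= t c.
  (* The range of the maximum defining [t] omits no chain: [shift c n] is in [la], so [n] is at most
     the number of rows. *)
  move=> c_mu Sn; have lt_n : n < (size la).+1.
    by have := chain_la _ _ c_mu Sn; rewrite in_young; lia.
  exact: (@leq_bigmax_cond _ _ (fun n : 'I__ => n : nat) (Ordinal lt_n)).
have t_adm : admissible la mu t.
  split=> [c d c_mu d_mu cd|c c_mu]; last exact: chain_la.
  apply: t_max => //; apply: has_chain_nw (t_chain c).
  by move: cd; rewrite /nw /shift /=; lia.
exists (shifted mu t); split; first exact: admissible_excited.
rewrite fsubsetD S_la; apply/fdisjointP => d dS; apply/imfsetP => /= -[c c_mu dE].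
(* If [shift c (t c)] were in [S], appending it to a longest chain would give one of length
   [(t c).+1]. *)
have : (t c).+1 <= t c; last by rewrite ltnn.
apply: t_max => //; apply/hasP; exists d => //.
rewrite dE; apply/andP; split; last exact: t_chain.
by rewrite /snw /shift /=; lia.
Qed.
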